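(* Let $X$ be a Čech-complete Lindelöf space. The following assertions are equivalent: (i) $C_p(X)$ is an Ascoli space; (ii) $C_p(X)$ is Fréchet–Urysohn; (iii) $X$ is scattered; (iv) $X$ is scattered and $\sigma$-compact.
   Context: For a Tychonoff space $Y$, $C_p(Y)$ and $C_k(Y)$ denote the set $C(Y)$ of all continuous real-valued functions on $Y$ with the topology of pointwise convergence and the compact-open topology, respectively. A Tychonoff space $Y$ is called Ascoli if every compact subset $\mathcal K$ of $C_k(Y)$ is evenly continuous, i.e. the evaluation map $Y\times\mathcal K\to\mathbb R$, $(y,f)\mapsto f(y)$, is continuous. A space $Y$ is Fréchet–Urysohn if for every $A\subseteq Y$ and $y\in\overline A$ there is a sequence in $A$ converging to $y$. A space is scattered if each of its nonempty subspaces has an isolated point. Čech-complete spaces are Tychonoff by definition. *)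

(* Defs.v *)
From HB Require Import structures.
From mathcomp Require Import all_boot all_order all_algebra.
From mathcomp Require Import all_classical all_reals all_analysis.
From mathcomp Require Import borel_hierarchy.

Set Implicit Arguments.
Unset Strict Implicit.
Unset Printing Implicit Defensive.

Import numFieldNormedType.Exports.
Local Open Scope classical_set_scope.

Definition tychonoff_space (X : topologicalType) : Prop :=
  hausdorff_space X /\ completely_regular_space X.

Definition lindelof_space (X : topologicalType) : Prop :=
  forall U : set (set X),
    U `<=` open -> \bigcup_(A in U) A = [set: X] ->
    exists V : set (set X),
      [/\ V `<=` U, countable V & \bigcup_(A in V) A = [set: X]].

Definition sigma_compact_space (X : topologicalType) : Prop :=
  exists2 K : (set X)^nat, (forall n, compact (K n)) & \bigcup_n K n = [set: X].

Definition scattered_space (X : topologicalType) : Prop :=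
  forall A : set X, A !=set0 -> isolated A !=set0.

Definition frechet_urysohn_space (X : topologicalType) : Prop :=
  forall (A : set X) (x : X), closure A x ->
    exists2 u : nat -> X, (forall n, A (u n)) & u @ \oo --> x.

Definition topological_embedding (X K : topologicalType) (e : X -> K) : Prop :=
  [/\ injective e, continuous e &
      forall U : set X, open U -> exists2 V : set K, open V & U = e @^-1` V].

Definition hausdorff_compactification
    (X K : topologicalType) (e : X -> K) : Prop :=
  [/\ compact [set: K], hausdorff_space K,
      topological_embedding e & dense (range e)].

(* A Tychonoff space that is a G_delta in some compactification; being a G_delta
   in some, in every, or in the Stone-Cech compactification are the usual
   interchangeable forms of the definition (Engelking, General Topology, 3.9). *)
Definition cech_complete_space (X : topologicalType) : Prop :=
  tychonoff_space X /\
  exists (K : topologicalType) (e : X -> K),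
    hausdorff_compactification e /\ Gdelta (range e).

(* The library puts no global topology on [continuousType X R]; the aliases [Cp]
   and [Ck] carry the subspace topologies induced by {ptws X -> R} and by
   {compact-open, X -> R} respectively. *)
Definition Cp (R : realType) (X : topologicalType) : Type := continuousType X R.

HB.instance Definition _ (R : realType) (X : topologicalType) :=
  Topological.copy (Cp R X)
    (initial_topology (fun f : continuousType X R => (f : {ptws X -> R}))).

Definition Ck (R : realType) (X : topologicalType) : Type := continuousType X R.

HB.instance Definition _ (R : realType) (X : topologicalType) :=
  Topological.copy (Ck R X)
    (initial_topology
       (fun f : continuousType X R => (f : {compact-open, X -> R}))).

Definition evenly_continuous (R : realType) (Y : topologicalType)
    (K : set (Ck R Y)) : Prop :=
  continuous (fun p : Y * set_type K => (\val p.2 : continuousType Y R) p.1).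

Definition ascoli_space (R : realType) (Y : topologicalType) : Prop :=
  tychonoff_space Y /\
  forall K : set (Ck R Y), compact K -> evenly_continuous K.

(* Main.v *)
(* (i) => (iii): if X is not scattered, a Cantor scheme in a compactification and
   Zorn's lemma yield a compact M in X with a countable pi-base (V k) all of whose
   traces on M are infinite; pick distinct points p k i in M and V k.  The functions
   Phi n (g) = prod_(k < n) sum_(i <= n) max (0, g (p k i) - n) on C_p(X) vanish for
   large n on each compact Q (otherwise nested pi-base elements produce a point of M
   at which Q is unbounded), so {0} and the Phi n form a compact subset of
   C_k(C_p(X)).  But a finite set of size at most n misses some p k i for each k < n,
   so every neighbourhood of 0 contains some a with Phi n (a) >= 1, and evaluation is
   discontinuous at (0, 0).
   (iii) => (iv): each point lies in a G_delta inside a compact subset of X, and a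
   Lindelof scattered regular space remains Lindelof in its G_delta-topology.
   (iv) => (ii): sigma-compactness of the finite powers of X gives countable
   tightness; the countably many functions involved are jointly constant on the pieces
   of a countable partition of X, so pointwise convergence need only be ensured on a
   countable set.
   (ii) => (i): a compact subset of C_k(Y) is equicontinuous along convergent
   sequences, hence equicontinuous when Y is Frechet-Urysohn. *)
Require Import Defs.
From mathcomp Require Import all_boot all_order all_algebra.
From mathcomp Require Import all_classical all_reals all_analysis.
From mathcomp Require Import borel_hierarchy.

Set Implicit Arguments.
Unset Strict Implicit.
Unset Printing Implicit Defensive.

Import Order.TTheory GRing.Theory Num.Theory.
From mathcomp Require Import lra.
Import numFieldNormedType.Exports.
Local Open Scope classical_set_scope.
Local Open Scope ring_scope.

(** * Compactness and Lindelof scattered spaces *)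

Lemma compact_nested_nonempty (X : topologicalType) (K : set X)
    (C : (set X)^nat) :
  compact K -> (forall n, closed (C n)) ->
  (forall n m, (n <= m)%N -> C m `<=` C n) ->
  (forall n, (K `&` C n) !=set0) -> exists2 x, K x & forall n, C n x.
Proof.
move=> /compact_near_coveringP cK clC decC C0; apply: contrapT => noX.
have [N _ /(_ N (leqnn N)) KC] : \forall n \near \oo, K `<=` (fun x => ~ C n x).
  apply: (cK nat \oo (fun n x => ~ C n x)) => x Kx.
  have [n nCx] : exists n, ~ C n x.
    by apply: contrapT => H; apply: noX; exists x => // n; apply: contrapT => ?;
      apply: H; exists n.
  exists (~` C n, [set m | (n <= m)%N]) => /=.
    split; last by exists n.
    by apply: open_nbhs_nbhs; split => //; exact: closed_openC.
  by move=> [y m] [/= nCy nm] Cy; apply: nCy; apply: decC nm _ Cy.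
by have [x [Kx Cx]] := C0 N; exact: (KC x).
Qed.

(** The tails of the chain [F] form a filter, along which near-covering compactness yields a single
    member. In the Zorn argument this shows that the union of a chain still contains no branch. *)
Lemma compact_chain_cover (X : topologicalType) (K : set X) (F : set (set X)) :
  compact K -> F !=set0 -> (forall A, F A -> open A) -> total_on F subset ->
  K `<=` \bigcup_(A in F) A -> exists2 A, F A & K `<=` A.
Proof.
move=> /compact_near_coveringP cK [A0 FA0] oF tF KF.
pose G := filter_from F (fun A => [set B | F B /\ A `<=` B]).
have GF : ProperFilter G.
  apply: filter_from_proper => [|A FA]; last by exists A; split.
  apply: filter_from_filter; first by exists A0.
  move=> A B FA FB; have [AB|BA] := tF A B FA FB.
    by exists B => // C [FC BC]; split; split => //; apply: subset_trans BC.
  by exists A => // C [FC BC]; split; split => //; apply: subset_trans BC.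
have GN : \forall A \near G, F A /\ K `<=` A.
  apply: filterI; first by exists A0 => // B [].
  apply: (cK _ G (fun A x => A x)) => x /KF[A FA Ax].
  exists (A, [set B | F B /\ A `<=` B]) => /=.
    by split; [apply: open_nbhs_nbhs; split => //; exact: oF | exists A].
  by move=> [y B] [/= Ay [_]]; apply.
by have [A [FA KA]] := filter_ex GN; exists A.
Qed.

(** A filter with no cluster point in the set avoids a neighbourhood of [l], hence all but finitely
    many terms, and then avoids those terms one by one. *)
Lemma compact_cvg_seq (X : topologicalType) (u : nat -> X) (l : X) :
  u @ \oo --> l -> compact [set x | x = l \/ exists n, x = u n].
Proof.
move=> ul F FF FS; apply: contrapT => nC.
have ncl x : x = l \/ (exists n, x = u n) -> ~ cluster F x.
  by move=> Sx clx; apply: nC; exists x.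
have sep x : ~ cluster F x -> exists2 V, nbhs x V & F (~` V).
  move=> nclx; apply: contrapT => H; apply: nclx => A B FA xB.
  apply: contrapT => AB; apply: H; exists B => //.
  by apply: filterS FA => y Ay By; apply: AB; exists y.
have [V lV FV] := sep l (ncl l (or_introl erefl)).
have [N _ NV] := ul V lV.
have FN n : F [set x | forall m, (m < n)%N -> x <> u m].
  elim: n => [|n IH]; first by apply: filterS filterT => x _ [].
  have [W nW FW] := sep (u n) (ncl (u n) (or_intror (ex_intro _ n erefl))).
  apply: filterS (filterI IH FW) => x [H nWx] m; rewrite ltnS leq_eqVlt.
  move=> /orP[/eqP->|/H//] xE; apply: nWx; rewrite xE; exact: nbhs_singleton nW.
have [x [[[|[n]] xE nVx H]]] := filter_ex (filterI (filterI FS FV) (FN N)).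
  by apply: nVx; rewrite xE; exact: nbhs_singleton lV.
have [nN|Nn] := ltnP n N; first exact: (H n nN).
by apply: nVx; rewrite xE; exact: NV.
Qed.

Lemma embedding_preimage_compact (X K : topologicalType) (e : X -> K)
    (L : set K) :
  topological_embedding e -> compact L -> L `<=` range e -> compact (e @^-1` L).
Proof.
move=> [inje ce oe] cL Le F FF FL.
have [y [Ly cly]] := cL (e @ F) _ FL.
have [x _ xy] := Le y Ly; exists x; split; first by rewrite /= xy.
move=> A B FA; rewrite nbhsE => -[U [oU Ux] UB].
have [V oV UE] := oe U oU.
have eFA : fmap e F (e @` A).
  by apply: (@filterS _ F) FA; exact: preimage_image.
have [|z [Az Vz]] := cly (e @` A) V eFA.
  by rewrite -xy; apply: open_nbhs_nbhs; split => //; move: Ux; rewrite UE.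
case: Az => w Aw wz; exists w; split => //; apply: UB; rewrite UE /=.
by rewrite wz.
Qed.

Lemma countable_range (T : Type) (D : set T) :
  countable D -> D !=set0 -> exists d : nat -> T, D = range d.
Proof.
move=> /countable_injP[f injf] [x0 Dx0].
pose P n x := D x /\ f x = n.
have H n : exists x, D x /\ ((exists y, P n y) -> P n x).
  have [[x Px]|nP] := pselect (exists y, P n y); first by exists x; case: (Px).
  by exists x0.
have [d dP] := choice H; exists d; apply/seteqP; split=> [x Dx|_ [n _ <-]].
  exists (f x) => //; have [Dd] := dP (f x).
  case; first by exists x.
  by move=> _ fd; apply: injf => //; apply/mem_set.
by have [] := dP n.
Qed.

(* The G_delta-topology of a Lindelof scattered regular space is Lindelof: the
   points with a neighbourhood covered by countably many of the sets
   [\bigcap_i V d i] form an open set, whose complement has no isolated point. *)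
Lemma scattered_lindelof_Gdelta (X : topologicalType) (I : countType)
    (V : X -> I -> set X) :
  @regular_space X -> lindelof_space X -> scattered_space X ->
  (forall x i, nbhs x (V x i)) ->
  exists2 D, countable D & forall x, exists2 d, D d & forall i, V d i x.
Proof.
move=> regX linX scX nV.
(* The points of [D] that serve [U] need not lie in [U]. *)
pose cov (U : set X) D := countable D /\
  forall x, U x -> exists2 d, D d & forall i, V d i x.
have covU U : (forall A, U A -> exists D, cov A D) -> countable U ->
    exists D, cov (\bigcup_(A in U) A) D.
  move=> UD cU.
  have H A : exists D, U A -> cov A D.
    have [/UD[D ?]|nUA] := pselect (U A); first by exists D.
    by exists set0.
  have [D DP] := choice H.
  exists (\bigcup_(A in U) D A); split.
    by apply: bigcup_countable => // A /DP[].
  move=> x [A UA Ax]; have [_ /(_ x Ax)[d Dd Vd]] := DP A UA.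
  by exists d => //; exists A.
pose G := [set A | open A /\ exists D, cov A D].
pose W := \bigcup_(A in G) A.
have oW : open W by apply: bigcup_open => A [].
have closed_cov (C : set X) : closed C -> C `<=` W -> exists D, cov C D.
  move=> clC CW.
  (* The complement of [C] completes the members of [G] to an open cover of the whole space; it is
     discarded once a countable subcover is found. *)
  have [| |U [UG cU UT]] := linX (G `|` [set ~` C]).
  - by move=> A [[]//|->]; exact: closed_openC.
  - apply/seteqP; split=> // x _; have [/CW[A GA Ax]|nCx] := pselect (C x).
      by exists A => //; left.
    by exists (~` C) => //; right.
  have [| |D [cD DP]] := covU (U `&` G).
  - by move=> A [_ []].
  - by apply: sub_countable cU; apply: subset_card_le => A [].
  exists D; split => // x Cx; apply: DP.
  have : [set: X] x by [].
  rewrite -UT => -[A UA Ax]; exists A => //; split=> //.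
  by case: (UG A UA) => // AE; move: Ax; rewrite AE.
have WT x : W x.
  apply: contrapT => nWx.
  have [p [/set_mem nWp [B pB BW]]] := scX (~` W) (ex_intro _ x nWx).
  apply: nWp.
  have [N pN NB] := regX p _ pB.
  have NW : forall y, closure N y -> y <> p -> W y.
    move=> y Ny yp; apply: contrapT => nWy; apply: yp.
    have : (B `&` ~` W) y by split=> //; exact: NB.
    by rewrite BW.
  (* Each shell is closed and omits [p], so it lies in [W]. The countably many shells together with
     the cell of [p] itself exhaust [N], which puts [p] in [W]. *)
  have H i : exists D, cov (closure N `&` ~` (V p i)^°) D.
    apply: closed_cov.
      apply: closedI; first exact: closed_closure.
      by apply: open_closedC; exact: open_interior.
    move=> y [Ny nVy]; apply: NW => // yp; apply: nVy; rewrite yp.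
    exact: nV.
  have [D HD] := choice H.
  exists (N^°); last exact: pN.
  split; first exact: open_interior.
  exists (p |` \bigcup_i D i); split.
    rewrite -bigcup2E; apply: bigcup_countable => [|[|[|n]] _] //=.

    by apply: bigcup_countable => // i _; have [] := HD i.
  move=> y /interior_subset Ny.
  have [ally|] := pselect (forall i, (V p i)^° y).
    by exists p; [left | move=> i; apply: interior_subset; exact: ally].
  move=> /existsNP[i nVi]; have [_ /(_ y)] := HD i.
  case; first by split => //; exact: subset_closure.
  by move=> d Dd dV; exists d => //; right; exists i.
have [| |D [cD DP]] := closed_cov setT; [exact: closedT|by move=> x _|].
by exists D => // x; exact: DP.
Qed.

(** * The space C_p(X) *)

Lemma initial_cvgP (S : choiceType) (T : topologicalType) (f : S -> T)
    (F : set_system S) (s : S) : Filter F ->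
  (F --> (s : initial_topology f)) <-> (f @ F --> f s).
Proof.
move=> FF; split=> [Fs|Ffs A].
  by apply: cvg_comp Fs _; exact: (@initial_continuous S T f).
move=> [_ [[B oB <-] Bfs sBA]].
have : nbhs (f s) B by apply: open_nbhs_nbhs.
by move=> /Ffs; exact: (@filterS _ F _ _ _ sBA).
Qed.

Definition Cp_eval (R : realType) (X : topologicalType) (x : X) (f : Cp R X) : R :=
  (f : continuousType X R) x.

Lemma Cp_cvgP (R : realType) (X : topologicalType) (F : set_system (Cp R X))
    (f : Cp R X) : Filter F ->
  F --> f <-> forall x, Cp_eval x g @[g --> F] --> Cp_eval x f.
Proof.
move=> FF; apply: (iff_trans (initial_cvgP
  (fun g : continuousType X R => (g : {ptws X -> R})) _ _)).
exact: pointwise_cvgP.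
Qed.

Lemma Cp_eval_continuous (R : realType) (X : topologicalType) (x : X) :
  continuous (@Cp_eval R X x).
Proof. by move=> f; apply: (Cp_cvgP f (nbhs_filter f)).1. Qed.

Lemma continuous_Cp_eval (R : realType) (X : topologicalType) (f : Cp R X) :
  continuous (fun x => Cp_eval x f).
Proof. exact: (@cts_fun _ _ (f : continuousType X R)). Qed.

(** The sets of functions agreeing with [f] on a finite set generate a filter that converges to [f]
    pointwise, so each neighbourhood of [f] contains one of them. *)
Lemma Cp_nbhsP (R : realType) (X : topologicalType) (f : Cp R X)
    (U : set (Cp R X)) : nbhs f U ->
  exists s : seq X, forall g,
    (forall x, x \in s -> Cp_eval x g = Cp_eval x f) -> U g.
Proof.
pose B (s : seq X) := [set g : Cp R X |
  forall x, x \in s -> Cp_eval x g = Cp_eval x f].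
have FB : Filter (filter_from setT B).
  apply: filter_fromT_filter; first by exists [::].
  move=> s t; exists (s ++ t) => g Bg.
  by split=> x xs; apply: Bg; rewrite mem_cat xs ?orbT.
have cB : filter_from setT B --> f.
  apply/Cp_cvgP => x A /nbhs_singleton Ax; exists [:: x] => // g Bg /=.
  by rewrite Bg // mem_head.
by move=> /cB[s _ sU]; exists s => g gs; apply: sU.
Qed.

Lemma Cp_tychonoff (R : realType) (X : topologicalType) :
  tychonoff_space (Cp R X).
Proof.
split; last first.
  exact: (@uniform_completely_regular R (initial_topology
    (fun g : continuousType X R => (g : {ptws X -> R})))).
move=> f g fg; apply: (@continuousEP X R f g).2 => x.
apply: (@Rhausdorff R) => A B fA gB.
have [h [Ah Bh]] := fg _ _ (Cp_eval_continuous fA) (Cp_eval_continuous gB).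
by exists (Cp_eval x h).
Qed.

(** * Sigma-compactness of scattered spaces *)

Lemma compact_hausdorff_regular (K : topologicalType) :
  compact [set: K] -> hausdorff_space K -> @regular_space K.
Proof.
by move=> cK hK x; apply: (compact_regular hK cK); exact: filterT.
Qed.

Lemma cech_complete_scattered_sigma_compact (R : realType) (X : topologicalType) :
  cech_complete_space X -> lindelof_space X -> scattered_space X ->
  sigma_compact_space X.
Proof.
move=> [[hX crX] [K [e [[cK hK emb _] [G oG eG]]]]] linX scX.
have regX : @regular_space X := @completely_regular_regular R X crX.
have [inje ce _] := emb.
have H x n : exists2 V, nbhs (e x) V & closure V `<=` G n.
  apply: (compact_hausdorff_regular cK hK); apply: open_nbhs_nbhs.
  by split => //; have : range e (e x) by []; rewrite eG; apply.
have {}H p : exists V, nbhs (e p.1) V /\ closure V `<=` G p.2.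
  by have [V ? ?] := H p.1 p.2; exists V.
have [V HV] := choice H.
(* [L x] is closed in the compactification and lies in every [G n], so its preimage is compact in
   [X]; it contains the G_delta cell of [x]. *)
pose L x := \bigcap_n closure (V (x, n)).
have Le x : L x `<=` range e.
  by rewrite eG => y Ly n _; have [_] := HV (x, n); apply; exact: Ly.
have cC x : compact (e @^-1` L x).
  apply: (embedding_preimage_compact emb) => //.
  apply: subclosed_compact cK _ => //.
  by apply: closed_bigI => n _; exact: closed_closure.
have [D cD DX] := @scattered_lindelof_Gdelta X nat
  (fun x n => e @^-1` V (x, n)) regX linX scX
  (fun x n => ce x _ (proj1 (HV (x, n)))).
have [[x0 _]|X0] := pselect ([set: X] !=set0); last first.
  exists (fun=> set0) => [_|]; first exact: compact0.
  by apply/seteqP; split=> // x _; case: X0; exists x.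
have [d DE] : exists d : nat -> X, D = range d.
  by apply: countable_range cD _; have [d Dd _] := DX x0; exists d.
exists (fun n => e @^-1` L (d n)) => [n|]; first exact: cC.
apply/seteqP; split=> // x _; have [y] := DX x; rewrite DE => -[n _ <-] xV.
by exists n => // m _; apply: subset_closure; exact: xV.
Qed.

(** * Frechet-Urysohn spaces are Ascoli *)

Lemma Ck_subbasic_open (R : realType) (Y : topologicalType) (S : set Y)
    (O : set R) : compact S -> open O ->
  open [set f : Ck R Y | forall y, S y -> O ((f : continuousType Y R) y)].
Proof.
move=> cS oO; exists [set g : {compact-open, Y -> R} | g @` S `<=` O].
  exact: compact_open_open.
apply/seteqP; split=> f /= H; first by move=> y Sy; apply: H; exists y.
by move=> _ [y Sy <-]; exact: H.
Qed.

Lemma frechet_urysohn_ascoli (R : realType) (Y : topologicalType) :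
  tychonoff_space Y -> frechet_urysohn_space Y -> ascoli_space R Y.
Proof.
move=> tY fuY; split=> // K cK.
pose ev (f : Ck R Y) := (f : continuousType Y R) : Y -> R.
have cev (f : Ck R Y) : continuous (ev f) by exact: (@cts_fun _ _ f).
have equi y (eps : R) : 0 < eps ->
    nbhs y [set z | forall f, K f -> `|ev f z - ev f y| < eps].
  move=> eps0; apply: contrapT => nU.
  pose A := [set z | exists2 f, K f & eps <= `|ev f z - ev f y|].
  have clA : closure A y.
    move=> B yB; apply: contrapT => AB; apply: nU; apply: filterS yB => z Bz f Kf.
    by rewrite ltNge; apply/negP => le; apply: AB; exists z; split => //; exists f.
  have [u Au uy] := fuY A y clA.
  have H n : exists f, K f /\ eps <= `|ev f (u n) - ev f y|.
    by have [f Kf le] := Au n; exists f.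
  have [f fP] := choice H.
  have [g [Kg clg]] : K `&` cluster (f @ \oo) !=set0.
    by apply: cK; exists 0%N => // n _; have [] := fP n.
  have eps2 : 0 < eps / 2 by rewrite divr_gt0.
  have [N _ NP] : \forall n \near \oo, ball (ev g y) (eps / 2) (ev g (u n)).
    have := cev g y _ (nbhsx_ballx (ev g y) _ eps2).
    exact: uy.
  (* The sequence is cut at [N] so that [g] stays within [eps / 2] of [g y] on all of [S]. A
     function of the sequence close to [g] on [S], with index at least [N], then varies by less than
     [eps] between [y] and [u n]. *)
  pose S := [set x | x = y \/ exists n, x = u (n + N)%N].
  have cS : compact S.
    apply: (@compact_cvg_seq _ (fun n => u (n + N)%N)).
    exact: (cvg_comp _ _ (@cvg_addnr N) uy).
  have := @Ck_subbasic_open R Y S (ball (ev g y) (eps / 2)) cS (@ball_open _ R^o (ev g y) _).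
  set Q := [set _ | _] => oQ.
  have gQ : nbhs g Q.
    apply: open_nbhs_nbhs; split => // z [->|[n ->]]; first exact: ballxx.
    by apply: NP; rewrite /= leq_addl.
  have fN : (f @ \oo) (f @` [set n | (N <= n)%N]).
    by exists N => // n Nn; exists n.
  have [_ [[n Nn <-] Qf]] := clg _ _ fN gQ.
  have [_] := fP n; rewrite leNgt => /negP; apply.
  have b1 := Qf y (or_introl erefl).
  have b2 : ball (ev g y) (eps / 2) (ev (f n) (u n)).
    by apply: Qf; right; exists (n - N)%N; rewrite subnK.
  by have := ball_splitr b1 b2; rewrite -ball_normE /= distrC.
move=> [y k] A /nbhs_ballP[eps /= eps0 epsA].
have eps2 : 0 < eps / 2 by rewrite divr_gt0.
have Kk : K (\val k) by exact: set_valP.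
(* One half of [eps] pays for changing the function at [y], the other, by equicontinuity, for moving
   from [y] to [z]. *)
pose Q := [set f : Ck R Y | ball (ev (\val k) y) (eps / 2) (ev f y)].
have oQ : open Q.
  have <- : [set f : Ck R Y | forall z, [set y] z ->
      ball (ev (\val k) y) (eps / 2) ((f : continuousType Y R) z)] = Q.
    by apply/seteqP; split=> f /=; [apply | move=> H _ ->].
  apply: Ck_subbasic_open; first exact: compact_set1.
  exact: (@ball_open _ R^o).
have kQ : nbhs k [set k' | Q (\val k')].
  have cv : continuous (fun k' : set_type K => \val k' : Ck R Y).
    exact: (@initial_continuous (set_type K) (Ck R Y) set_val).
  by apply: (cv k); apply: open_nbhs_nbhs; split => //; exact: ballxx.
exists ([set z | forall f, K f -> `|ev f z - ev f y| < eps / 2],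
        [set k' | Q (\val k')]) => /=.
  by split=> //; exact: equi.
move=> [z k'] [/= zU k'Q]; apply: epsA.
apply: (@ball_split _ _ (ev (\val k') y)).
  exact: k'Q.
rewrite -ball_normE /= distrC; apply: zU; exact: set_valP.
Qed.

Lemma eq_natSinv (R : realType) (a b : R) :
  (forall n, `|a - b| < n.+1%:R^-1) -> a = b.
Proof.
move=> ab; apply/eqP; rewrite -subr_eq0 -normr_le0 leNgt; apply/negP => ab0.
have [N _ /(_ N (leqnn N))] := near_infty_natSinv_lt (PosNum ab0).
by rewrite /= ltNge (ltW (ab N)).
Qed.

(** * The Frechet-Urysohn property of C_p(X) *)

Section Cp_frechet_urysohn.
Context (R : realType) (X : topologicalType).

(** For each tuple some [g] in [A] is close to [f] at all its coordinates, and stays so on a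
    neighbourhood of the tuple. The product of the pieces is compact by Tychonoff, so finitely many
    [g] suffice for it. *)
Lemma Cp_sigma_compact_tightness (K : nat -> set X) (A : set (Cp R X))
    (f : Cp R X) :
  (forall n, compact (K n)) -> closure A f ->
  exists B : nat * seq nat -> seq (Cp R X),
    (forall j g, g \in B j -> A g) /\
    forall n (s : seq nat) (x : 'I_(size s) -> X),
      (forall i : 'I_(size s), K (nth 0%N s i) (x i)) ->
      exists2 g, g \in B (n, s) &
        forall i, `|Cp_eval (x i) g - Cp_eval (x i) f| < n.+1%:R^-1.
Proof.
move=> cK clA.
have H (j : nat * seq nat) : exists t : seq (Cp R X),
    (forall g, g \in t -> A g) /\
    forall (x : 'I_(size j.2) -> X),
      (forall i : 'I_(size j.2), K (nth 0%N j.2 i) (x i)) ->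
      exists2 g, g \in t &
        forall i, `|Cp_eval (x i) g - Cp_eval (x i) f| < j.1.+1%:R^-1.
  case: j => n s /=.
  have n0 : 0 < n.+1%:R^-1 :> R by rewrite invr_gt0.
  have := @tychonoff 'I_(size s) (fun=> X) (fun i => K (nth 0%N s i))
    (fun i => cK _).
  move/compact_near_coveringP.
  (* Finite lists of functions are directed by inclusion; near-covering compactness along this
     filter gives one list good for the whole product. *)
  pose F : set_system (seq (Cp R X)) :=
    filter_from setT
      (fun u : seq (Cp R X) => [set t : seq (Cp R X) | {subset u <= t}]).
  pose P (t : seq (Cp R X)) (x : 'I_(size s) -> X) := exists g, [/\ g \in t, A g &
    forall i, `|Cp_eval (x i) g - Cp_eval (x i) f| < n.+1%:R^-1].
  have FF : ProperFilter F.
    apply: filter_from_proper => [|t _]; last by exists t.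
    apply: filter_fromT_filter; first by exists [::].
    move=> t u; exists (t ++ u) => v tuv.
    by split=> g gt; apply: tuv; rewrite mem_cat gt ?orbT.
  move=> /(_ _ F P _)[x _|].
    have [g [Ag gx]] : A `&` [set g | forall i,
        ball (Cp_eval (x i) f) n.+1%:R^-1 (Cp_eval (x i) g)] !=set0.
      apply: clA; apply: (filter_forall (nbhs_filter f)) => i.
      by apply: (@Cp_eval_continuous R X (x i) f); exact: nbhsx_ballx.
    pose d (y : X) := Cp_eval y g - Cp_eval y f.
    have cd : continuous d.
      by move=> y; apply: cvgB; exact: continuous_Cp_eval.
    exists ([set x' : {ptws 'I_(size s) -> X} |
               forall i, ball (0 : R) n.+1%:R^-1 (d (x' i))],
            [set t | g \in t]) => /=.
      split; last by exists [:: g] => // t; apply; rewrite mem_head.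
      apply: (filter_forall (nbhs_filter (x : {ptws 'I_(size s) -> X}))) => i.
      have cdi : continuous ((fun h => d (h i)) : {ptws 'I_(size s) -> X} -> R).
        move=> y; apply: (@continuous_comp {ptws 'I_(size s) -> X} X R
          (fun h => h i) d); last exact: cd.
        exact: (@proj_continuous _ (fun=> X) i y).
      apply: (cdi x); apply: open_nbhs_nbhs; split; first exact: (@ball_open _ R^o).
      rewrite -ball_normE /= sub0r normrN.
      by have := gx i; rewrite -ball_normE /= distrC.
    move=> [x' t] [/= x'd gt]; exists g; split => // i.
    by have := x'd i; rewrite -ball_normE /= sub0r normrN.
  move=> t0 _ /(_ t0 (fun _ => id)) tP.
  exists [seq g <- t0 | `[< A g >]]; split.
    by move=> g; rewrite mem_filter => /andP[/asboolP].
  move=> x /tP[g [gt Ag gx]]; exists g => //.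
  by rewrite mem_filter gt andbT; apply/asboolP.
have [B BP] := choice H; exists B; split=> [j|n s]; first by have [] := BP j.
by have [_] := BP (n, s).
Qed.

Lemma Cp_frechet_urysohn : @regular_space X -> lindelof_space X ->
  scattered_space X -> sigma_compact_space X -> frechet_urysohn_space (Cp R X).
Proof.
move=> regX linX scX [K cK KT] A f clA.
have [a0 [Aa0 _]] : A `&` setT !=set0 by apply: clA; exact: filterT.
have [B [BA BP]] := Cp_sigma_compact_tightness cK clA.
(* The default [a0] belongs to [A], so every [b i] does, even past the end of a list. *)
pose b (i : (nat * seq nat) * nat) := nth a0 (B i.1) i.2.
have bA i : A (b i).
  rewrite /b; have [iB|Bi] := ltnP i.2 (size (B i.1)).
    exact: BA _ _ (mem_nth a0 iB).
  by rewrite nth_default.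
(* Lying in all the [V x i] means giving [f] and every [b i] the same value as at [x]. *)
pose V x (i : ((nat * seq nat) * nat) * nat) :=
  [set y | `|Cp_eval x (b i.1) - Cp_eval y (b i.1)| < i.2.+1%:R^-1] `&`
  [set y | `|Cp_eval x f - Cp_eval y f| < i.2.+1%:R^-1].
have nV x i : nbhs x (V x i).
  by apply: filterI; (apply: cvgr_dist_lt; last by rewrite invr_gt0);
    exact: continuous_Cp_eval.
have [D cD DX] := scattered_lindelof_Gdelta regX linX scX nV.
have {}DX x : exists2 d, D d & Cp_eval x f = Cp_eval d f /\
    forall i, Cp_eval x (b i) = Cp_eval d (b i).
  have [d Dd dx] := DX x; exists d => //; split=> [|i]; apply/esym/eq_natSinv => n.
    by have [] := dx ((0%N, [::], 0%N), n).
  by have [] := dx (i, n).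
have [[x0 _]|X0] := pselect ([set: X] !=set0); last first.
  exists (fun=> a0) => //; apply/Cp_cvgP => x; case: X0; by exists x.
have [d DE] : exists d : nat -> X, D = range d.
  by apply: countable_range cD _; have [d Dd _] := DX x0; exists d.
have Kd m : exists k, K k (d m).
  have : [set: X] (d m) by [].
  by rewrite -KT => -[k _ Kk]; exists k.
have [tau tauP] := choice Kd.
have H n : exists i, forall m, (m <= n)%N ->
    `|Cp_eval (d m) (b i) - Cp_eval (d m) f| < n.+1%:R^-1.
  (* [s] lists compact pieces containing [d 0], ..., [d n], to which the finite list [B (n, s)] is
     adapted. *)
  pose s := mkseq tau n.+1.
  have [|g gB gd] := BP n s (fun i => d i).
    move=> i; rewrite nth_mkseq; first exact: tauP.
    by rewrite -(size_mkseq tau n.+1) ltn_ord.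
  exists ((n, s), index g (B (n, s))) => m mn.
  have ms : (m < size s)%N by rewrite size_mkseq.
  by rewrite /b /= nth_index //; exact: (gd (Ordinal ms)).
have [i iP] := choice H.
exists (b \o i) => [n|]; first exact: bA.
apply/Cp_cvgP => x.
suff : Cp_eval x (b (i n)) @[n --> \oo] --> Cp_eval x f by [].
apply/cvgrPdist_lt => eps eps0.
have [y] := DX x; rewrite DE => -[m _ <-] [-> bE].
near=> n; rewrite [Cp_eval x _](bE (i n)) distrC.
apply: lt_trans (iP n m _) _.
  by near: n; exists m.
near: n; exact: (near_infty_natSinv_lt (PosNum eps0)).
Unshelve. all: by end_near. Qed.

End Cp_frechet_urysohn.

(** * A countable pi-base in a non-scattered space *)

(* [b 0, ..., b (n - 1)] in reverse order, so that nodes of the binary tree grow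
   by [cons]. *)
Fixpoint rev_prefix (b : nat -> bool) (n : nat) : seq bool :=
  if n is m.+1 then b m :: rev_prefix b m else [::].

Lemma eq_rev_prefix (b c : nat -> bool) n :
  (forall m, (m < n)%N -> b m = c m) -> rev_prefix b n = rev_prefix c n.
Proof.
elim: n => //= n IH bc; rewrite bc // IH // => m mn.
by apply: bc; apply: ltn_trans mn _.
Qed.

Lemma size_rev_prefix b n : size (rev_prefix b n) = n.
Proof. by elim: n => //= n ->. Qed.

Lemma rev_prefix_size (s : seq bool) : exists b, rev_prefix b (size s) = s.
Proof.
elim: s => [|a s [b bs]]; first by exists (fun=> true).
exists (fun n => if n == size s then a else b n) => /=; rewrite eqxx.
congr cons; rewrite -[RHS]bs; apply: eq_rev_prefix => m.
by case: eqVneq => // ->; rewrite ltnn.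
Qed.

(* A Cantor scheme [U] in [K] inside a crowded subset of [X], whose branches [C b]
   lie in [X]. A maximal open set [O] containing no branch has a complement [M]
   which meets every branch minimally, so that the traces [M `&` U s] form a
   countable pi-base of [M]. *)
Lemma not_scattered_pi_base (X K : topologicalType) (e : X -> K) :
  compact [set: K] -> hausdorff_space K -> topological_embedding e ->
  Gdelta (range e) -> ~ scattered_space X ->
  exists (M : set X) (V : nat -> set X) (p : nat -> nat -> X),
    [/\ compact M, forall k, open (V k),
        forall k i, M (p k i) /\ V k (p k i),
        forall k, injective (p k) &
        forall W, open W -> M `&` W !=set0 -> exists k, M `&` V k `<=` W].
Proof.
move=> cK hK emb [G oG eG] nsc.
have [inje ce _] := emb.
have [A [[x0 Ax0] Acrowd]] : exists A : set X, A !=set0 /\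
    forall x B, A x -> nbhs x B -> exists y, [/\ A y, B y & y <> x].
  apply: contrapT => nA; apply: nsc => A [x0 Ax0].
  apply: contrapT => iA; apply: nA; exists A; split; first by exists x0.
  move=> x B Ax xB; apply: contrapT => nB; apply: iA; exists x.
  split; first exact/mem_set.
  exists B => //; apply/seteqP; split=> [y [By Ay]|_ ->].
    by apply: contrapT => yx; apply: nB; exists y.
  by split => //; exact: nbhs_singleton.
(* A good set meets the image of the crowded set [A], so it contains two distinct points of that
   image and can be split again. *)
pose good U := open U /\ exists2 x, A x & U (e x).
have eGn x n : G n (e x).
  have : range e (e x) by exists x.
  by rewrite eG; apply.
have shrink U n x : open U -> U (e x) -> exists2 B,
    nbhs (e x) B & closure B `<=` U `&` G n.
  move=> oU Ux; apply: (compact_hausdorff_regular cK hK).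
  by apply: open_nbhs_nbhs; split; [exact: openI | split].
have stepP (Un : set K * nat) : exists f : bool -> set K, good Un.1 ->
    (forall b, good (f b) /\ closure (f b) `<=` Un.1 `&` G Un.2) /\
    f true `&` f false = set0.
  case: Un => U n /=.
  have [[oU [x Ax Ux]]|ngU] := pselect (good U); last by exists (fun=> set0).
  have [y [Ay Uy yx]] : exists y, [/\ A y, U (e y) & y <> x].
    by apply: (Acrowd x (e @^-1` U) Ax); apply: ce; exact: open_nbhs_nbhs.
  have exy : e x != e y by apply/eqP => /inje /esym.
  move: (hK); rewrite open_hausdorff => /(_ _ _ exy)[[/= B C]].
  rewrite !inE => -[Bx Cy] [oB oC BC0].
  have [B' xB' B'U] := shrink U n x oU Ux.
  have [C' yC' C'U] := shrink U n y oU Uy.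
  exists (fun b => if b then B `&` B'^° else C `&` C'^°) => _; split.
    case; split.
    - split; first by apply: openI => //; exact: open_interior.
      by exists x => //; split.
    - apply: subset_trans B'U; apply: closureS => z [_]; exact: interior_subset.
    - split; first by apply: openI => //; exact: open_interior.
      by exists y => //; split.
    - apply: subset_trans C'U; apply: closureS => z [_]; exact: interior_subset.
  by apply/seteqP; split=> // z [[Bz _] [Cz _]]; rewrite -BC0.
have [F FP] := choice stepP.
pose U := fix U (s : seq bool) : set K :=
  if s is b :: s' then F (U s', size s') b else setT.
have gU s : good (U s).
  elim: s => [|b s IH] /=; first by split; [exact: openT | exists x0].
  by have [/(_ b)[]] := FP (U s, size s) IH.
have clU b s : closure (U (b :: s)) `<=` U s `&` G (size s).
  by have [/(_ b)[]] := FP (U s, size s) (gU s).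
have disjU s : U (true :: s) `&` U (false :: s) = set0.
  by have [] := FP (U s, size s) (gU s).
have consU b s : U (b :: s) `<=` U s.
  by move=> z Uz; have [] := clU b s z (subset_closure Uz).
have catU t s : U (t ++ s) `<=` U s.
  by elim: t => //= b t IH; apply: subset_trans IH; exact: consU.
pose C b := \bigcap_n closure (U (rev_prefix b n)).
have clC b : closed (C b) by apply: closed_bigI => n _; exact: closed_closure.
have cC b : compact (C b) by exact: subclosed_compact cK _.
have decC b n m : (n <= m)%N ->
    closure (U (rev_prefix b m)) `<=` closure (U (rev_prefix b n)).
  move=> nm; apply: closureS; rewrite -(subnK nm).
  by elim: (m - n)%N => //= d IH; apply: subset_trans IH; exact: consU.
have C0 b : C b !=set0.
  have [|||z _ Cz] := @compact_nested_nonempty K setT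
    (fun n => closure (U (rev_prefix b n))) cK.
  - by move=> n; exact: closed_closure.
  - exact: decC.
  - move=> n; have [_ [x _ Ux]] := gU (rev_prefix b n).
    by exists (e x); split => //; exact: subset_closure.
  - by exists z => n _; exact: Cz.
have CU b n : C b `<=` U (rev_prefix b n).
  by move=> z Cz; have [] := clU (b n) (rev_prefix b n) z (Cz n.+1 I).
have Copen b W : open W -> C b `<=` W ->
    exists n, closure (U (rev_prefix b n)) `<=` W.
  move=> oW CW; apply: contrapT => nW.
  have [|||z _ Cz] := @compact_nested_nonempty K setT
    (fun n => closure (U (rev_prefix b n)) `&` ~` W) cK.
  - by move=> n; apply: closedI; [exact: closed_closure | exact: open_closedC].
  - by move=> n m nm z [/(decC b n m nm)].
  - move=> n; apply: contrapT => H; apply: nW; exists n => z Uz.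
    by apply: contrapT => nWz; apply: H; exists z.
  - by have [_] := Cz 0%N; apply; apply: CW => n _; have [] := Cz n.
have [Q [[oQ QC] Qmax]] : exists Q, (open Q /\ forall b, ~ C b `<=` Q) /\
    forall B, Q `<` B -> ~ (open B /\ forall b, ~ C b `<=` B).
  apply: (@Zorn_bigcup K (fun Q => open Q /\ forall b, ~ C b `<=` Q)).
  move=> H HP totH; split; first by apply: bigcup_open => B /HP[].
  move=> b; have [[B0 HB0]|H0] := pselect (H !=set0).
    move=> /(compact_chain_cover (cC b) (ex_intro _ B0 HB0)).
    move=> /(_ _ totH)[|B HB]; first by move=> B /HP[].
    by have [_ /(_ b)] := HP B HB.
  move=> CH; have [z /CH[B HB]] := C0 b.
  by case: H0; exists B.
pose M := ~` Q.
have MU n z : M z -> exists2 s, size s = n & closure (U s) z.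
  (* [T] is a finite union, hence closed, and contains every branch. Adding its complement to [Q]
     therefore captures no branch, and maximality forces that complement into [Q]. *)
  move=> Mz; pose T := \bigcup_(t in [set: n.-tuple bool]) closure (U t).
  have clT : closed T.
    by apply: closed_bigcup => [|t _]; [exact: finite_finset | exact: closed_closure].
  have [[t _ Utz]|nTz] := pselect (T z).
    by exists t => //; rewrite size_tuple.
  case: (Qmax (Q `|` ~` T)).
    split; first by left.
    by move=> /(_ z); move=> H; apply: Mz; apply: H; right.
  split; first by apply: openU => //; exact: closed_openC.
  move=> b CQT; apply: (QC b) => y Cy; case: (CQT y Cy) => // nTy.
  case: nTy; have sb : size (rev_prefix b n) == n by rewrite size_rev_prefix.
  by exists (Tuple sb) => //; exact: Cy.
have Me : M `<=` range e.
  move=> z Mz; rewrite eG => n _; have [[|b s]//= [sn] Uz] := MU n.+1 z Mz.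
  by have [_] := clU b s z Uz; rewrite sn.
have MUs s : (M `&` U s) !=set0.
  have [b bs] := rev_prefix_size s.
  have : ~ C b `<=` Q by [].
  move=> /existsNP[z /not_implyP[Cz nQz]]; exists z; split => //.
  by rewrite -bs; exact: CU.
have Mpi W : open W -> M `&` W !=set0 -> exists s, M `&` U s `<=` W.
  move=> oW [z [Mz Wz]].
  (* By maximality [Q] enlarged by [W] swallows a branch, hence, by compactness, a whole node of it;
     outside [Q] that node lies in [W]. *)
  have [b CQW] : exists b, C b `<=` Q `|` W.
    apply: contrapT => nb; apply: (Qmax (Q `|` W)).
      split; first by left.
      by move=> H; apply: Mz; apply: H; right.
    by split; [exact: openU | move=> b CQW; apply: nb; exists b].
  have [n UQW] := Copen b _ (openU oQ oW) CQW.
  exists (rev_prefix b n) => y [My Uy].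
  by case: (UQW y (subset_closure Uy)).
(* From [s], turn to [false] [i] times and then once to [true]: these nodes are pairwise disjoint,
   so the points chosen in them are distinct. *)
pose node s i := true :: nseq i false ++ s : seq bool.
have H (si : seq bool * nat) : exists x, (M `&` U (node si.1 si.2)) (e x).
  have [z [Mz Uz]] := MUs (node si.1 si.2).
  by have [x _ xz] := Me z Mz; exists x; rewrite xz.
have [q qP] := choice H.
have qinj s i j : (i < j)%N -> q (s, i) <> q (s, j).
  move=> ij qE; have [_ Ui] := qP (s, i); have [_ Uj] := qP (s, j).
  have : (U (true :: nseq i false ++ s) `&` U (false :: nseq i false ++ s))
      (e (q (s, i))).
    split=> //; rewrite qE; move: Uj; rewrite /node /=.
    move=> /consU; rewrite -(subnK ij) nseqD -catA; exact: catU.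
  by rewrite disjU.
(* Integers that encode no node stand for the root. *)
pose dec k : seq bool := odflt [::] (unpickle k).
exists (e @^-1` M), (fun k => e @^-1` U (dec k)), (fun k i => q (dec k, i)).
split.
- apply: (embedding_preimage_compact emb) => //.
  by apply: subclosed_compact cK _ => //; exact: open_closedC.
- by move=> k; apply: open_comp => [x _|]; [exact: ce | have [] := gU (dec k)].
- move=> k i; have [Mq /consU Uq] := qP (dec k, i); split => //.
  exact: catU Uq.
- move=> k i j qE; case: (ltngtP i j) => // /(qinj (dec k)); first by rewrite qE.
  by move/nesym; rewrite qE.
- move=> W oW [x [Mx Wx]]; have [_ _ oe] := emb.
  have [W' oW' WE] := oe W oW.
  have [|s sW] := Mpi W' oW'.
    by exists (e x); split => //; move: Wx; rewrite WE.
  exists (pickle s) => y; rewrite /dec pickleK /= => -[My Uy].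
  by rewrite WE; exact: sW.
Qed.

(** * Peak functions and the failure of the Ascoli property *)

Section pi_base_not_ascoli.
Context (R : realType) (X : topologicalType) (M : set X) (V : nat -> set X)
  (p : nat -> nat -> X).
Hypotheses (crX : completely_regular_space X) (hX : hausdorff_space X).
Hypotheses (cM : compact M) (oV : forall k, open (V k))
  (pMV : forall k i, M (p k i) /\ V k (p k i))
  (pinj : forall k, injective (p k))
  (piV : forall W, open W -> M `&` W !=set0 -> exists k, M `&` V k `<=` W).

(* [peak n g != 0] iff for each [k < n] some [i <= n] has [g (p k i) > n]. *)
Definition peak (n : nat) (g : Cp R X) : R :=
  \prod_(k < n) \sum_(i < n.+1) Num.max 0 (Cp_eval (p k i) g - n%:R).

Lemma peak_continuous n : continuous (peak n).
Proof.
move=> g; have Fg := nbhs_filter g.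
apply: (@cvg_big R _ _ _ _ (@mul_continuous R) _ (nbhs g)) => k _.
apply: (@cvg_big R _ _ _ _ (@add_continuous R) _ (nbhs g)) => i _.
apply: (@continuous_max R (Cp R X) (fun=> 0)
  (fun g => Cp_eval (p k i) g - n%:R)); first exact: cvg_cst.
by apply: cvgB; [exact: Cp_eval_continuous | exact: cvg_cst].
Qed.

Lemma peak_compact_eq0 (Q : set (Cp R X)) : compact Q ->
  exists N, forall n, (N <= n)%N -> forall g, Q g -> peak n g = 0.
Proof.
move=> cQ; apply: contrapT => nN.
have H (nk : nat * nat) : exists gk : Cp R X * nat, Q gk.1 /\
    M `&` V gk.2 `<=` [set x | nk.1%:R < Cp_eval x gk.1] `&` V nk.2.
  case: nk => N k /=.
  have [n [g [Nn kn Qg gn]]] : exists n g,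
      [/\ (N <= n)%N, (k < n)%N, Q g & peak n g != 0].
    (* The bound [k.+1] ensures that the factor of index [k] occurs in [peak n]. *)
    apply: contrapT => H; apply: nN; exists (maxn N k.+1) => n.
    rewrite geq_max => /andP[Nn kn] g Qg; apply/eqP/negPn/negP => gn.
    by apply: H; exists n, g.
  have /existsP[i ni] : [exists i : 'I_n.+1, n%:R < Cp_eval (p k i) g].
    apply: contraNT gn => /existsPn gn.
    rewrite /peak (bigD1 (Ordinal kn)) //= big1 ?mul0r // => i _.
    by apply/max_idPl; rewrite subr_le0 leNgt gn.
  have [||k' k'P] := piV (W := [set x | n%:R < Cp_eval x g] `&` V k).
  - apply: openI => //; apply: (open_comp _ (@open_gt R n%:R)) => x _.
    exact: continuous_Cp_eval.
  - by exists (p k i); have [? ?] := pMV k i.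
  exists (g, k'); split=> // x /k'P[/= ngx Vx]; split => //.
  by apply: le_lt_trans ngx; rewrite ler_nat.
have [next nextP] := choice H.
pose kap := fix kap n := if n is m.+1 then (next (m, kap m)).2 else 0%N.
pose g n := (next (n, kap n)).1.
have kapP n : M `&` V (kap n.+1) `<=`
    [set x | n%:R < Cp_eval x (g n)] `&` V (kap n).
  by have [_] := nextP (n, kap n).
have [|||x _ xcl] := @compact_nested_nonempty X M
  (fun n => closure (M `&` V (kap n))) cM.
- by move=> n; exact: closed_closure.
- move=> n m nm; apply: closureS; rewrite -(subnK nm).
  elim: (m - n)%N => //= d IH; apply: subset_trans IH => x Mx.
  by split; [case: Mx | have [] := kapP _ _ Mx].
- move=> n; have [Mp Vp] := pMV (kap n) 0%N.
  by exists (p (kap n) 0%N); split => //; exact: subset_closure.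
(* Only the weak inequality survives the passage to the closure, and it suffices: a cluster point
   [h] of the [g n] would need some [g n] with large [n] to be within 1 of [h] at [x]. *)
have gx n : n%:R <= Cp_eval x (g n).
  have clg : closed [set y | n%:R <= Cp_eval y (g n)].
    apply: (closed_comp _ (@closed_ge R n%:R)) => y _.
    exact: continuous_Cp_eval.
  apply: clg; apply: closureS (xcl n.+1) => y /kapP[/= /ltW ? _].
  by [].
have [h [Qh clh]] : Q `&` cluster (g @ \oo) !=set0.
  by apply: cQ; exists 0%N => // n _; have [] := nextP (n, kap n).
pose B := Num.bound (`|Cp_eval x h| + 1).
have gB : (g @ \oo) (g @` [set n | (B <= n)%N]).
  by exists B => // n Bn; exists n.
have hB : nbhs h [set g' | ball (Cp_eval x h) 1 (Cp_eval x g')].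
  by apply: (@Cp_eval_continuous R X x h); exact: nbhsx_ballx.
have [_ [[n Bn <-]]] := clh _ _ gB hB.
rewrite -ball_normE /= => xh1.
have Bge : `|Cp_eval x h| + 1 < B%:R by apply: archi_boundP; rewrite addr_ge0.
have nB : B%:R <= n%:R :> R by rewrite ler_nat.
have := gx n; have := ler_norm (Cp_eval x h); move: xh1 Bge nB.
rewrite ltr_norml => /andP[h1 h2] h3 h4 h5 h6.
lra.
Qed.

Lemma closed_seq (s : seq X) : closed [set` s].
Proof.
move/hausdorff_accessible/accessible_finite_set_closed : hX; apply.
exact: finite_seq.
Qed.

(** By pigeonhole one of the [n.+1] distinct points [p k i] avoids [s]; a sum of bumps at such
    points, one for each [k < n], makes every factor of the peak at least 1. *)
Lemma peak_ge1 (s : seq X) n : (size s <= n)%N -> exists a : Cp R X,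
  (forall x, x \in s -> Cp_eval x a = 0) /\ 1 <= peak n a.
Proof.
move=> sn.
have Hj k : exists i : 'I_n.+1, p k i \notin s.
  apply/existsP; apply: contraT => /existsPn ps.
  have : (size (mkseq (p k) n.+1) <= size s)%N.
    apply: uniq_leq_size; first by rewrite mkseq_uniq //; exact: pinj.
    move=> _ /mapP[i + ->]; rewrite mem_iota /= add0n => ni.
    by have := ps (Ordinal ni); rewrite negbK.
  by rewrite size_mkseq leqNgt ltnS sn.
have [j jP] := choice Hj.
have Hh k : exists h : X -> R, [/\ continuous h, forall x, 0 <= h x,
    h (p k (j k)) = 1 & forall x, x \in s -> h x = 0].
  have := crX (closed_seq (s := s)) (negP (jP k)).
  (* The separating [f] is 0 at the chosen point and 1 on [s], hence the flip to [1 - f]. *)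
  move/(@uniform_separatorP _ R) => [f [cf f01 f0 f1]].
  exists (fun x => 1 - f x); split.
  - by move=> x; apply: cvgB; [exact: cvg_cst | exact: cf].
  - move=> x; rewrite subr_ge0.
    have /= : `[0, 1]%classic (f x) by apply: f01; exists x.
    by rewrite in_itv /= => /andP[].
  - by rewrite (f0 (f (p k (j k)))) ?subr0 //; exists (p k (j k)).
  - by move=> x xs; rewrite (f1 (f x)) ?subrr //; exists x.
have [h hP] := choice Hh.
(* The height [n.+1] exceeds the threshold [n] of the peak by 1, and the other bumps, being
   nonnegative, cannot lower it. *)
pose a x : R := \sum_(k < n) n.+1%:R * h k x.
have ca : continuous a.
  move=> x; apply: (@cvg_big R _ _ _ _ (@add_continuous R) _ (nbhs x)) => k _.
  by apply: cvgM; [exact: cvg_cst | have [+ _ _ _] := hP k; apply].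
exists (mkcts ca : continuousType X R); split=> [x xs|].
  rewrite /Cp_eval /= /mkcts /a big1 // => k _.
  by have [_ _ _ ->] := hP k => //; rewrite mulr0.
rewrite /peak; apply: (big_ind (fun y : R => 1 <= y)) => // [x y x1 y1|k _].
  by rewrite -[1]mulr1 ler_pM.
rewrite (bigD1 (j k)) //=.
have ak : n.+1%:R <= a (p k (j k)).
  rewrite /a (bigD1 k) //=; have [_ _ -> _] := hP k.
  rewrite mulr1 lerDl; apply: sumr_ge0 => i _; apply: mulr_ge0 => //.
  by have [_] := hP i.
apply: (@le_trans _ _ (Num.max 0 (a (p k (j k)) - n%:R))); last first.
  by rewrite lerDl; apply: sumr_ge0 => i _; rewrite le_max lexx.
by rewrite le_max lerBrDr -natr1 addrC in ak *; rewrite ak orbT.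
Qed.

Lemma pi_base_not_ascoli : ~ ascoli_space R (Cp R X).
Proof.
case=> _ ascX.
pose Phi n : Ck R (Cp R X) := mkcts (@peak_continuous n) : continuousType _ _.
have c0 : continuous (cst 0 : Cp R X -> R) by exact: cst_continuous.
pose zero : Ck R (Cp R X) := mkcts c0 : continuousType _ _.
have Phi0 : Phi @ \oo --> zero.
  apply/(@initial_cvgP _ _ (fun f : continuousType (Cp R X) R =>
    (f : {compact-open, Cp R X -> R}))).
  apply/compact_open_cvgP => Q O cQ oO zO.
  have [N NP] := peak_compact_eq0 cQ.
  exists N => // n Nn _ [g Qg <-] /=; apply: zO; exists g => //.
  by rewrite /= /mkcts NP.
pose KK := [set f | f = zero \/ exists n, f = Phi n].
have cKK : compact KK by exact: compact_cvg_seq.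
have KPhi n : KK (Phi n) by right; exists n.
have Kz : KK zero by left.
pose phi n : set_type KK := exist _ (Phi n) (mem_set (KPhi n)).
pose z : set_type KK := exist _ zero (mem_set Kz).
have phiz : phi @ \oo --> z.
  exact/(@initial_cvgP _ _ (set_val : set_type KK -> Ck R (Cp R X))).
have cz : continuous (cst 0 : X -> R) by exact: cst_continuous.
pose z0 : Cp R X := mkcts cz : continuousType X R.
have := ascX KK cKK (z0, z) _ (nbhsx_ballx (0 : R) 1 ltr01).
case=> -[U W] /= [/Cp_nbhsP[s sU] zW] UW.
have [N _ NW] := phiz W zW.
(* The index is at least [N] to enter [W], and at least [size s] to leave room for the
   pigeonhole. *)
have [a [as0 a1]] := @peak_ge1 s (maxn N (size s)) (leq_maxr _ _).
have Ua : U a by apply: sU => x /as0 ->.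
have Wphi : W (phi (maxn N (size s))) by apply: NW; rewrite /= leq_maxl.
have := UW (a, phi (maxn N (size s))) (conj Ua Wphi); rewrite /= -ball_normE /=.
rewrite /mkcts sub0r normrN ltNge => /negP; apply.
exact: le_trans a1 (ler_norm _).
Qed.

End pi_base_not_ascoli.

Lemma ascoli_Cp_scattered (R : realType) (X : topologicalType) :
  cech_complete_space X -> ascoli_space R (Cp R X) -> scattered_space X.
Proof.
move=> [[hX crX] [K [e [[cK hK emb _] Ge]]]] ascX; apply: contrapT.
move/(not_scattered_pi_base cK hK emb Ge) => [M [V [p [cM oV pMV pinj piV]]]].
exact: (@pi_base_not_ascoli R X M V p).
Qed.

Theorem corollary2p12 (R : realType) (X : topologicalType)
    (X_cech_complete : cech_complete_space X) (X_lindelof : lindelof_space X) :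
  [<-> ascoli_space R (Cp R X);
       frechet_urysohn_space (Cp R X);
       scattered_space X;
       scattered_space X /\ sigma_compact_space X].
Proof.
have [[hX crX] _] := X_cech_complete.
have regX : @regular_space X := @completely_regular_regular R X crX.
have sc_sigma : scattered_space X -> sigma_compact_space X.
  exact: cech_complete_scattered_sigma_compact.
have sc_fu : scattered_space X -> frechet_urysohn_space (Cp R X).
  by move=> scX; apply: Cp_frechet_urysohn => //; exact: sc_sigma.
have fu_asc : frechet_urysohn_space (Cp R X) -> ascoli_space R (Cp R X).
  by apply: frechet_urysohn_ascoli; exact: Cp_tychonoff.
have asc_sc : ascoli_space R (Cp R X) -> scattered_space X.
  exact: ascoli_Cp_scattered.
tfae=> [/asc_sc/sc_fu//|/fu_asc/asc_sc//|scX|[/sc_fu/fu_asc//]].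
by split => //; exact: sc_sigma.
Qed.
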